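(* Let $U$ and $V$ be real Hilbert spaces, $F\colon U\to V$ a bounded linear operator, and $\mathcal{R}\colon U\to[0,+\infty]$ a convex, lower semi-continuous and coercive functional. Let $v^\dagger\in V$ and let $u^\dagger\in\operatorname{arg\,min}_u\{\mathcal{R}(u): Fu=v^\dagger\}$. Assume that for some $0<\nu\le1/2$ there exist $\omega^\dagger\in U$ and $$\xi^\dagger:=(F^*F)^\nu\omega^\dagger\in\partial\mathcal{R}(u^\dagger).$$ Then for every $M>0$ there exist constants $C_1,C_2,C_3>0$ such that $$\mathcal{D}_{\xi^\dagger}(u_\alpha^\delta,u^\dagger)\le C_1\frac{\delta^2}{\alpha}+C_2\delta^{2\nu}+C_3\alpha^{\frac{\nu}{1-\nu}}$$ for all $\delta,\alpha>0$ with $\delta^2/\alpha\le M$, all $v^\delta\in V$ with $\lVert v^\delta-v^\dagger\rVert\le\delta$, and all minimisers $u_\alpha^\delta$ of $\mathcal{T}_\alpha(u,v^\delta)=\frac12\lVert Fu-v^\delta\rVert^2+\alpha\mathcal{R}(u)$. In particular, with a parameter choice $\alpha(\delta)\sim\delta^{2-2\nu}$ one obtains the convergence rate $\mathcal{D}_{\xi^\dagger}(u_\alpha^\delta,u^\dagger)\lesssim\delta^{2\nu}$ as $\delta\to0$; that is, for all $0<c\le c'$ there exist $\delta_0>0$ and $C>0$ such that $\mathcal{D}_{\xi^\dagger}(u_\alpha^\delta,u^\dagger)\le C\delta^{2\nu}$ for all $0<\delta\le\delta_0$, all $\alpha$ with $c\,\delta^{2-2\nu}\le\alpha\le c'\delta^{2-2\nu}$,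 all $v^\delta\in V$ with $\lVert v^\delta-v^\dagger\rVert\le\delta$, and all minimisers $u_\alpha^\delta$ of $\mathcal{T}_\alpha(\cdot,v^\delta)$.
   Context: Coercive means $\mathcal{R}(u)\to+\infty$ as $\lVert u\rVert\to\infty$. The subdifferential $\partial\mathcal{R}(u)$ is the set of $\xi\in U$ with $\mathcal{R}(u)<\infty$ and $\mathcal{R}(w)\ge\mathcal{R}(u)+\langle\xi,w-u\rangle$ for all $w\in U$. Fractional powers $(F^*F)^\nu$ are defined by the spectral calculus. For $\xi\in\partial\mathcal{R}(u)$ the Bregman distance is $\mathcal{D}_\xi(\tilde u,u)=\mathcal{R}(\tilde u)-\mathcal{R}(u)-\langle\xi,\tilde u-u\rangle$. The constants may depend on all fixed data ($F,\mathcal{R},u^\dagger,\xi^\dagger,\omega^\dagger,\nu$, and $M$, respectively $c,c'$) but not on $\delta$, $\alpha$, $v^\delta$ or the minimiser. *)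

(* Defs.v *)
From HB Require Import structures.
From mathcomp Require Import all_boot all_order all_algebra.
From mathcomp Require Import sesquilinear.
From mathcomp Require Import all_classical all_reals all_analysis.

Set Implicit Arguments.
Unset Strict Implicit.
Unset Printing Implicit Defensive.

Import Order.TTheory GRing.Theory Num.Theory.
Import numFieldNormedType.Exports.

Local Open Scope classical_set_scope.
Local Open Scope ring_scope.

(* A real Hilbert space: a complete normed space whose norm is induced by a
   symmetric, positive definite bilinear form. *)
HB.mixin Record CompleteNormedModule_isHilbert (R : realType) U
    of CompleteNormedModule R U := {
  hdot : {dot U for (idfun : R -> R)} ;
  hdot_norm : forall u : U, hdot u u = `|u| ^+ 2
}.

#[short(type="hilbertType")]
HB.structure Definition Hilbert (R : realType) :=
  {U of CompleteNormedModule R U & CompleteNormedModule_isHilbert R U}.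

Section Operators.
Context {R : realType}.
Implicit Types U V : hilbertType R.

Definition is_adjoint U V (F : U -> V) (Fs : V -> U) : Prop :=
  forall (u : U) (v : V), hdot (F u) v = hdot u (Fs v).

(* Only meant for bounded self-adjoint A, whose (complex) spectrum is real. *)
Definition spectrum U (A : U -> U) : set R :=
  [set l | ~ exists S : {linear U -> U},
     [/\ continuous S,
         cancel (fun u => A u - l *: u) S &
         cancel S (fun u => A u - l *: u)]].

Definition poly_op U (p : {poly R}) (A : U -> U) (u : U) : U :=
  \sum_(i < size p) p`_i *: iter i A u.

Definition opnorm_cvg U (A_ : nat -> U -> U) (B : U -> U) : Prop :=
  forall e : R, 0 < e ->
    \forall n \near \oo, forall u : U, `|A_ n u - B u| <= e * `|u|.

(* B = f(A) in the continuous spectral calculus of the bounded self-adjoint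
   operator A: f(A) is the limit in operator norm of p_n(A), for polynomials
   p_n converging to f uniformly on the spectrum of A.  As
   `|p(A)| = sup_(spectrum A) `|p|, B does not depend on the choice of p_n;
   it exists (Weierstrass) for every f continuous on the spectrum. *)
Definition is_spectral_calculus U (A : U -> U) (f : R -> R) (B : U -> U) :=
  exists p : nat -> {poly R},
    {uniform spectrum A, (fun n t => (p n).[t]) @ \oo --> f} /\
    opnorm_cvg (fun n => poly_op (p n) A) B.

(* B = A^nu, for A bounded, self-adjoint and nonnegative, and nu > 0. *)
Definition is_fractional_power U (A : U -> U) (nu : R) (B : U -> U) :=
  is_spectral_calculus A (fun t => t `^ nu) B.

End Operators.

Section Functionals.
Context {R : realType} {U : hilbertType R}.
Implicit Types (J : U -> \bar R) (u w xi : U).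
Local Open Scope ereal_scope.

(* With 0 * +oo = 0, the cases t = 0 and t = 1 hold trivially. *)
Definition convex_functional J : Prop :=
  forall u w (t : R), (0 <= t <= 1)%R ->
    J (t *: u + (1 - t) *: w)%R <= t%:E * J u + (1 - t)%:E * J w.

Definition coercive J : Prop :=
  forall a : R, exists r : R, forall u, (r <= `|u|)%R -> a%:E <= J u.

Definition is_argmin J (A : set U) u : Prop :=
  A u /\ forall w, A w -> J u <= J w.

Definition subdifferential J u : set U :=
  [set xi | J u < +oo /\ forall w, J u + (hdot xi (w - u)%R)%:E <= J w].

(* Used only for J u finite, so that no +oo - +oo occurs. *)
Definition bregman J xi ut u : \bar R :=
  J ut - J u - (hdot xi (ut - u)%R)%:E.

Definition tikhonov (V : hilbertType R) (F : U -> V) J (alpha : R) (v : V) u :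
    \bar R :=
  (2^-1 * `|F u - v| ^+ 2)%:E + alpha%:E * J u.

End Functionals.

(* Main.v *)
Require Import Defs.
From HB Require Import structures.
From mathcomp Require Import all_boot all_order all_algebra.
From mathcomp Require Import sesquilinear.
From mathcomp Require Import all_classical all_reals all_analysis.
From mathcomp Require Import complex.
From mathcomp Require Import ring lra.
Import Order.TTheory GRing.Theory Num.Theory.
Import numFieldNormedType.Exports.
Local Open Scope classical_set_scope.
Local Open Scope ring_scope.

(** The estimate follows from an interpolation inequality for the fractional
    power [B = A^nu] of [A = F^* F].  If [s > 0] and [|F w| <= s], then
      [|<B omega, w>| = |<omega, B w>| <= 4 |omega| (|w| + 1) s^(2 nu)]
    ([source_element_le]).

    Let [ua] be a minimiser and [n = |F ua - v|] its residual.  Comparing the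
    values of the functional at [ua] and at [ud] bounds [J ua - J ud] by
    [delta^2 / (2 alpha) - n^2 / (2 alpha)].  Hence [J ua] is bounded, and by
    coercivity so is [ua - ud].  As [|F (ua - ud)| <= n + delta], the linear
    term of the Bregman distance is at most a multiple of
    [n^(2 nu) + delta^(2 nu)].  By Young's inequality [powR_absorb] the term
    [- n^2 / (2 alpha)] absorbs [n^(2 nu)] at the price of
    [alpha^(nu / (1 - nu))].  The second claim inserts
    [alpha ~ delta^(2 - 2 nu)].

    For the interpolation inequality, the scalar function [t^(2 nu)] lies below
    the line [lam^(2 nu) (1 + t / lam)] on the half-line [t >= 0], for every
    [lam > 0].  This passes to operators because a polynomial that is at least
    [c] on the spectrum of a bounded self-adjoint operator [A] satisfies
    [q(A) >= c] ([poly_op_ge]); here [q] is a combination of [1], ['X] and the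
    square of a polynomial approximating [t^nu].

    To prove [poly_op_ge], let [m] be the infimum of the numerical range of
    [q(A)].  Then [q(A) - m] is not invertible ([numerical_range_bottom]),
    whereas a polynomial without roots in the spectrum has an invertible value
    at [A] ([poly_op_invertible]): its linear factors are invertible by the
    definition of the spectrum, and its irreducible quadratic factors take
    coercive values, which are invertible by a fixed point argument
    ([coercive_invertible]).  So [q] takes the value [m] on the spectrum. *)

(** * Inner products *)

Section InnerProduct.
Context {R : realType} {U : hilbertType R}.
Implicit Types (u v w : U) (a : R).

Lemma hdotC u v : hdot u v = hdot v u.
Proof. by have := hermC (@hdot R U) u v; rewrite /= expr0 mul1r. Qed.

Lemma hdotDl u v w : hdot (u + v) w = hdot u w + hdot v w.
Proof. exact: linearDl. Qed.

Lemma hdotDr u v w : hdot w (u + v) = hdot w u + hdot w v.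
Proof. by rewrite !(hdotC w) hdotDl. Qed.

Lemma hdotZl a u w : hdot (a *: u) w = a * hdot u w.
Proof. exact: linearZl_LR. Qed.

Lemma hdotZr a u w : hdot w (a *: u) = a * hdot w u.
Proof. by rewrite !(hdotC w) hdotZl. Qed.

Lemma hdotBl u v w : hdot (u - v) w = hdot u w - hdot v w.
Proof. by rewrite -scaleN1r hdotDl hdotZl mulN1r. Qed.

Lemma hdotBr u v w : hdot w (u - v) = hdot w u - hdot w v.
Proof. by rewrite !(hdotC w) hdotBl. Qed.

Lemma hdot0l w : hdot 0 w = 0.
Proof. by rewrite -(scale0r (0 : U)) hdotZl mul0r. Qed.

Lemma hdot_normB u v : `|u - v| ^+ 2 = `|u| ^+ 2 - 2 * hdot u v + `|v| ^+ 2.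
Proof. by rewrite -!hdot_norm hdotBl !hdotBr (hdotC v u); ring. Qed.

Lemma hdot_le u v : hdot u v <= `|u| * `|v|.
Proof.
have [->|u0] := eqVneq u 0; first by rewrite hdot0l normr0 mul0r.
have nu : 0 < `|u| by rewrite normr_gt0.
(* This square vanishes exactly in the case of equality. *)
have := sqr_ge0 `| `|v| *: u - `|u| *: v|.
rewrite hdot_normB hdotZl hdotZr !normrZ !normr_id => h.
have [->|v0] := eqVneq v 0; first by rewrite hdotC hdot0l normr0 mulr0.
have nv : 0 < `|v| by rewrite normr_gt0.
have nuv : 0 < `|u| * `|v| by rewrite mulr_gt0.
rewrite -(ler_pM2l nuv); nra.
Qed.

Lemma hdot_norm_le u v : `|hdot u v| <= `|u| * `|v|.
Proof.
by rewrite ler_norml hdot_le lerNl -mulN1r -hdotZl scaleN1r -(normrN u) hdot_le.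
Qed.

Lemma hdot_inj u v : (forall w, hdot w u = hdot w v) -> u = v.
Proof.
move=> h; apply/eqP; rewrite -subr_eq0 -normr_eq0 -sqrf_eq0 -hdot_norm.
by rewrite hdotBr h subrr.
Qed.

End InnerProduct.

(** * Bounded self-adjoint operators *)

Section SelfAdjoint.
Context {R : realType} {U : hilbertType R}.
Implicit Types (A T S : U -> U) (u w : U) (a c k l : R).

Definition bounded_op T := exists2 k, 0 < k & forall u, `|T u| <= k * `|u|.

Definition selfadjoint T := is_adjoint T T /\ bounded_op T.

Definition invertible T :=
  exists S, [/\ bounded_op S, cancel T S & cancel S T].

(** Symmetry alone forces linearity, because the vectors [T (a *: u + w)] and [a *: T u + T w] have the same
    inner product with every vector. *)
Lemma adjoint_linear T : is_adjoint T T -> linear T.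
Proof.
move=> sT a u w; apply: hdot_inj => x.
by rewrite -sT !(hdotDr, hdotZr) !sT.
Qed.

Lemma bounded_comp T S : bounded_op T -> bounded_op S -> bounded_op (T \o S).
Proof.
move=> [k k0 bT] [l l0 bS]; exists (k * l); first exact: mulr_gt0.
by move=> u; rewrite -mulrA (le_trans (bT _))// ler_pM2l.
Qed.

Lemma bounded_lin T S a :
  bounded_op T -> bounded_op S -> bounded_op (fun u => a *: T u + S u).
Proof.
move=> [k k0 bT] [l l0 bS]; exists (`|a| * k + l).
  by rewrite ltr_wpDl// mulr_ge0// ltW.
move=> u; rewrite mulrDl -mulrA (le_trans (ler_normD _ _))// lerD// normrZ.
by rewrite ler_wpM2l.
Qed.

Lemma bounded_id : bounded_op (fun u => u).
Proof. by exists 1 => // u; rewrite mul1r. Qed.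

Lemma bounded0 : bounded_op (fun _ => 0).
Proof. by exists 1 => // u; rewrite normr0 mul1r. Qed.

Lemma invertible_comp T S : invertible T -> invertible S -> invertible (T \o S).
Proof.
move=> [T' [bT TT' T'T]] [S' [bS SS' S'S]]; exists (S' \o T'); split.
- exact: bounded_comp.
- exact: can_comp.
- exact: can_comp.
Qed.

Lemma selfadjoint_shift A l : selfadjoint A -> selfadjoint (fun u => A u - l *: u).
Proof.
move=> [sA bA]; split; first by move=> u w; rewrite hdotBl hdotBr hdotZl hdotZr sA.
have := bounded_lin _ _ (- l) bounded_id bA; congr bounded_op.
by apply/funext => u; rewrite addrC scaleNr.
Qed.

(** A coercive operator is inverted by a fixed point iteration: for a small
    enough step [a], the map [u |-> u - a (T u - f)] is a contraction, and its
    fixed point solves [T u = f]. *)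
Lemma coercive_invertible T c : 0 < c -> selfadjoint T ->
  (forall u, c * `|u| ^+ 2 <= hdot (T u) u) -> invertible T.
Proof.
move=> c0 [sT [k0 k00 bT0]] cT.
(* Adding [c] to the bound ensures [c <= k], so that [q2] below is nonnegative. *)
pose k := k0 + c.
have k_gt0 : 0 < k by rewrite addr_gt0.
have bT u : `|T u| <= k * `|u|.
  by rewrite (le_trans (bT0 u))// ler_wpM2r// lerDl ltW.
have Tl := adjoint_linear _ sT.
have TB u w : T (u - w) = T u - T w.
  by rewrite -scaleN1r addrC Tl scaleN1r addrC.
have Tlb u : c * `|u| <= `|T u|.
  have [->|u0] := eqVneq u 0; first by rewrite normr0 mulr0.
  have nu : 0 < `|u| by rewrite normr_gt0.
  rewrite -(ler_pM2r nu) (le_trans _ (hdot_le _ _))//.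
  by rewrite (le_trans _ (cT u))// expr2 mulrA.
have Tinj u w : T u = T w -> u = w.
  move=> e; apply/eqP; rewrite -subr_eq0 -normr_eq0.
  have := Tlb (u - w); rewrite TB e subrr normr0 pmulr_rle0// => h.
  by rewrite eq_le h normr_ge0.
have Tsurj f : exists u, T u = f.
  (* This step minimises [1 - 2 a c + a^2 k^2], a bound of the square of the
     Lipschitz constant; the minimum is [q2]. *)
  pose a := c / k ^+ 2.
  have a_gt0 : 0 < a by rewrite divr_gt0// exprn_gt0.
  pose g (u : U) := u - a *: (T u - f).
  have gU : set_fun [set: U] [set: U] g by [].
  pose gf := [the {fun [set: U] >-> [set: U]} of mkfun gU].
  pose q2 := 1 - c * a.
  have q20 : 0 <= q2.
    rewrite subr_ge0 /a mulrA ler_pdivrMr ?exprn_gt0// mul1r -expr2 lerXn2r//.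
    - by rewrite nnegrE ltW.
    - by rewrite nnegrE ltW.
    - by rewrite lerDr ltW.
  have ctr : is_contraction gf.
    exists (NngNum (sqrtr_ge0 q2)); split => /=.
      by rewrite -sqrtr1 ltr_sqrt// gtrBl mulr_gt0.
    move=> [u w] _ /=; rewrite /g.
    have -> : u - a *: (T u - f) - (w - a *: (T w - f)) =
        (u - w) - a *: T (u - w).
      by rewrite opprD addrACA -opprD -scalerBr opprB addrA subrK -TB.
    rewrite -(@ler_pXn2r _ 2)// ?nnegrE ?mulr_ge0 ?sqrtr_ge0//.
    rewrite exprMn sqr_sqrtr// hdot_normB hdotZr normrZ (gtr0_norm a_gt0).
    rewrite hdotC exprMn.
    have h1 := cT (u - w).
    have h2 : `|T (u - w)| ^+ 2 <= k ^+ 2 * `|u - w| ^+ 2.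
      by rewrite -exprMn lerXn2r// ?nnegrE// mulr_ge0// ltW.
    have h3 : a ^+ 2 * `|T (u - w)| ^+ 2 <= a * c * `|u - w| ^+ 2.
      apply: le_trans (_ : a ^+ 2 * (k ^+ 2 * `|u - w| ^+ 2) <= _).
        by rewrite ler_wpM2l// sqr_ge0.
      rewrite mulrA ler_wpM2r// ?sqr_ge0// expr2 -mulrA ler_pM2l// /a.
      by rewrite divfK// expf_neq0// gt_eqF.
    have h4 := ler_wpM2l (ltW a_gt0) h1.
    rewrite /q2; nra.
  have [p _ /= pp] := banach_fixed_point ctr closedT (ex_intro _ 0 I).
  exists p; apply/eqP; rewrite -subr_eq0.
  have : a *: (T p - f) == 0.
    by rewrite -oppr_eq0 -(inj_eq (addrI p)) addr0 {3}pp.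
  by rewrite scaler_eq0 gt_eqF.
have [S TS] := choice Tsurj.
exists S; split => //; last by move=> u; apply: Tinj; rewrite TS.
exists c^-1; first by rewrite invr_gt0.
by move=> u; rewrite ler_pdivlMl// -{2}(TS u).
Qed.

End SelfAdjoint.

(** * The bottom of the numerical range *)

Section NumericalRange.
Context {R : realType} {U : hilbertType R}.
Implicit Types (T : U -> U) (u w : U) (c m : R).

(** For [T >= 0] with bound [k], expanding [0 <= <T w, w>] at
    [w = u - k^-1 T u] leaves this bound: a form of the Cauchy-Schwarz
    inequality for the semidefinite form of [T]. *)
Lemma nonneg_norm_le T : selfadjoint T -> (forall u, 0 <= hdot (T u) u) ->
  exists2 k, 0 < k & forall u, `|T u| ^+ 2 <= k * hdot (T u) u.
Proof.
move=> [sT [k k0 bT]] T0; exists k => // u.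
have Tl := adjoint_linear _ sT.
have := T0 (u - k^-1 *: T u).
have -> : T (u - k^-1 *: T u) = T u - k^-1 *: T (T u).
  by rewrite addrC -scaleNr Tl scaleNr addrC.
rewrite hdotBl !hdotBr !hdotZl !hdotZr (sT (T u) u) !hdot_norm => h.
have h1 : hdot (T (T u)) (T u) <= k * `|T u| ^+ 2.
  by rewrite (le_trans (hdot_le _ _))// expr2 mulrA ler_wpM2r.
have h2 : k^-1 * hdot (T (T u)) (T u) <= `|T u| ^+ 2 by rewrite ler_pdivrMl.
rewrite -ler_pdivrMl//.
have h3 : k^-1 * (k^-1 * hdot (T (T u)) (T u)) <= k^-1 * `|T u| ^+ 2.
  by rewrite ler_pM2l// invr_gt0.
lra.
Qed.

(** The number [m] is the infimum of the numerical range of [T].  If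
    [T - m] had a bounded inverse, then [|u|] would be at most a multiple of
    [|(T - m) u|], hence [|u|^2] at most a multiple of [<(T - m) u, u>] by
    [nonneg_norm_le], and a number larger than [m] would still be a lower
    bound. *)
Lemma numerical_range_bottom T (u0 : U) : u0 != 0 -> selfadjoint T ->
  exists2 m, forall u, m * `|u| ^+ 2 <= hdot (T u) u &
    ~ invertible (fun u => T u - m *: u).
Proof.
move=> u00 aT.
pose L := [set c | forall u, c * `|u| ^+ 2 <= hdot (T u) u].
have Lub u : u != 0 -> ubound L (hdot (T u) u / `|u| ^+ 2).
  by move=> uN0 c /(_ u) h; rewrite ler_pdivlMr// exprn_gt0// normr_gt0.
have L0 : L !=set0.
  have [_ [k k0 bT]] := aT; exists (- k) => u.
  have /ler_normlP[+ _] := hdot_norm_le (T u) u.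
  rewrite lerNl; apply: le_trans.
  by rewrite mulNr lerN2 expr2 mulrA ler_wpM2r.
have Lsup : has_sup L by split => //; eexists; exact: Lub u00.
have Lm u : sup L * `|u| ^+ 2 <= hdot (T u) u.
  have [->|uN0] := eqVneq u 0; first by rewrite normr0 expr0n mulr0 hdotC hdot0l.
  rewrite -ler_pdivlMr ?exprn_gt0 ?normr_gt0//.
  by apply: sup_le_ub => //; exact: Lub.
exists (sup L) => // -[S [[s s0 bS] TS _]].
have aTm := selfadjoint_shift _ (sup L) aT.
have [|k k0 hk] := nonneg_norm_le _ aTm.
  by move=> u; rewrite hdotBl hdotZl hdot_norm subr_ge0.
have sk : 0 < s ^+ 2 * k by rewrite mulr_gt0// exprn_gt0.
suff /(ub_le_sup Lsup.2) : L (sup L + (s ^+ 2 * k)^-1).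
  by rewrite gerDl leNgt invr_gt0 sk.
move=> u; rewrite mulrDl -lerBrDl ler_pdivrMl//.
have := hk u; rewrite hdotBl hdotZl hdot_norm => h.
rewrite -mulrA; apply: le_trans (ler_wpM2l (sqr_ge0 s) h).
by rewrite -exprMn lerXn2r// ?nnegrE ?mulr_ge0 ?(ltW s0)// -{1}(TS u) bS.
Qed.

End NumericalRange.

(** * Polynomials in an operator *)

Section PolyOp.
Context {R : realType} {U : hilbertType R}.
Implicit Types (A S : U -> U) (u w : U) (p q : {poly R}) (a b c l t : R).

Lemma poly_op_widen p A u n : (size p <= n)%N ->
  poly_op p A u = \sum_(i < n) p`_i *: iter i A u.
Proof.
move=> pn; rewrite /poly_op (big_ord_widen n (fun i => p`_i *: iter i A u))//.
rewrite big_mkcond; apply: eq_bigr => i _; case: ltnP => // h.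
by rewrite nth_default// scale0r.
Qed.

Lemma poly_opD p q A u : poly_op (p + q) A u = poly_op p A u + poly_op q A u.
Proof.
pose n := maxn (size p) (size q).
rewrite !(poly_op_widen _ _ _ n) ?leq_maxl ?leq_maxr ?size_polyD//.
by rewrite -big_split; apply: eq_bigr => i _; rewrite coefD scalerDl.
Qed.

Lemma poly_opZ a p A u : poly_op (a *: p) A u = a *: poly_op p A u.
Proof.
rewrite !(poly_op_widen _ _ _ (size p)) ?size_scale_leq// scaler_sumr.
by apply: eq_bigr => i _; rewrite coefZ scalerA.
Qed.

Lemma poly_opB p q A u : poly_op (p - q) A u = poly_op p A u - poly_op q A u.
Proof. by rewrite -scaleN1r poly_opD poly_opZ scaleN1r. Qed.

Lemma poly_opC a A u : poly_op a%:P A u = a *: u.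
Proof.
by rewrite (poly_op_widen _ _ _ 1) ?size_polyC_leq1// big_ord1 coefC.
Qed.

Lemma poly_opMX p A u : poly_op (p * 'X) A u = poly_op p A (A u).
Proof.
rewrite (poly_op_widen _ _ _ (size p).+1); last first.
  by rewrite (leq_trans (size_polyMleq _ _))// size_polyX addn2.
rewrite big_ord_recl coefMX eqxx scale0r add0r.
by apply: eq_bigr => i _; rewrite coefMX/= -iterS iterSr.
Qed.

Lemma poly_opX A u : poly_op 'X A u = A u.
Proof. by rewrite -[X in poly_op X](mul1r 'X) poly_opMX poly_opC scale1r. Qed.

Lemma poly_op_comm p A u : linear A -> poly_op p A (A u) = A (poly_op p A u).
Proof.
move=> lA; pose lAm := GRing.isLinear.Build R U U *:%R A lA.
pose Al : {linear U -> U} := HB.pack A lAm.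
rewrite /poly_op -[RHS]/(Al _) linear_sum.
by apply: eq_bigr => i _; rewrite linearZ -iterSr.
Qed.

Lemma poly_opM p q A u : linear A ->
  poly_op (p * q) A u = poly_op p A (poly_op q A u).
Proof.
move=> lA; elim/poly_ind: p u => [|p c IH] u.
  by rewrite mul0r -(scale0r (1 : {poly R})) !poly_opZ !scale0r.
rewrite mulrDl poly_opD mulrAC poly_opMX IH mul_polyC poly_opZ.
by rewrite poly_opD poly_opMX poly_opC poly_op_comm.
Qed.

Lemma selfadjoint_poly_op p A : selfadjoint A -> selfadjoint (poly_op p A).
Proof.
move=> [sA bA]; have lA := adjoint_linear _ sA; split.
  elim/poly_ind: p => [|p c IH] u w.
    by rewrite -(scale0r (1 : {poly R})) !poly_opZ !scale0r hdot0l hdotC hdot0l.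
  by rewrite !poly_opD !poly_opMX !poly_opC hdotDl hdotDr hdotZl hdotZr
    poly_op_comm// sA IH.
elim/poly_ind: p => [|p c IH].
  have := @bounded0 _ U; congr bounded_op; apply/funext => u.
  by rewrite -(scale0r (1 : {poly R})) !poly_opZ !scale0r.
have := bounded_lin _ _ c bounded_id (bounded_comp _ _ IH bA).
congr bounded_op; apply/funext => u.
by rewrite poly_opD poly_opMX poly_opC addrC.
Qed.

End PolyOp.

(** * Polynomials without roots in the spectrum *)

(** Let [a + i b] be a complex root of [q], with [b != 0], and let [d] be the
    quadratic polynomial.  The remainder of [q] modulo [d] has real
    coefficients, degree at most 1, and the root [a + i b], so it is 0. *)
Lemma real_root_or_quadratic_factor {R : rcfType} (q : {poly R}) :
  (1 < size q)%N -> (exists a, root q a) \/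
    exists a b, b != 0 /\ ('X - a%:P) ^+ 2 + (b ^+ 2)%:P %| q.
Proof.
move=> sq; pose qC := map_poly (real_complex R) q.
have /closed_rootP[[a b] zr] : size qC != 1%N by rewrite size_map_poly gtn_eqF.
have [b0|bN0] := eqVneq b 0.
  left; exists a; rewrite b0 in zr.
  by rewrite -(fmorph_root (real_complex R)).
right; exists a, b; split => //.
set d := _ + _.
have sd : size d = 3%N.
  rewrite size_polyDl size_exp_XsubC// (leq_ltn_trans (size_polyC_leq1 _))//.
set r := q %% d.
have sr : (size r <= 2)%N by rewrite -ltnS -sd ltn_modp -size_poly_gt0 sd.
have dz : root (map_poly (real_complex R) d) (a +i* b)%C.
  rewrite /root rmorphD rmorphXn/= map_polyXsubC map_polyC/= !hornerE.
  by apply/eqP; simpc; rewrite /= ; congr (_ +i* _)%C; ring.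
have rz : root (map_poly (real_complex R) r) (a +i* b)%C.
  have := zr; rewrite /qC {1}(divp_eq q d) rmorphD rmorphM/=.
  by rewrite /root !hornerE (eqP dz) mulr0 add0r.
have rE : r = r`_1 *: 'X + (r`_0)%:P.
  apply/polyP => -[|[|i]]; rewrite !(coefD, coefZ, coefX, coefC)/= ?mulr1 ?mulr0
    ?addr0 ?add0r//.
  by rewrite nth_default// (leq_trans sr).
move: rz; rewrite rE /root rmorphD/= map_polyZ map_polyX map_polyC/= !hornerE.
simpc => /eqP[/[swap]] /eqP; rewrite mulf_eq0 (negPf bN0) orbF => /eqP r1.
rewrite r1 mul0r add0r => r0.
by rewrite /dvdp -/r rE r1 r0 scale0r add0r.
Qed.

Section Spectrum.
Context {R : realType} {U : hilbertType R}.
Implicit Types (A T S : U -> U) (u w : U) (p q : {poly R}) (a b c l t : R).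

Lemma notin_spectrum_invertible A l : ~ spectrum A l ->
  invertible (fun u => A u - l *: u).
Proof.
move=> /contrapT[S [cS AS SA]]; exists S; split => //.
have /linear_bounded_continuous/linear_boundedP/pinfty_ex_gt0[k k0 bS] := cS.
by exists k.
Qed.

Lemma invertible_notin_spectrum A l : selfadjoint A ->
  invertible (fun u => A u - l *: u) -> ~ spectrum A l.
Proof.
move=> aA [S [[k k0 bS] AS SA]]; apply.
have [sT _] := selfadjoint_shift _ l aA.
have sS : is_adjoint S S by move=> u w; rewrite -{1}(SA w) -sT SA.
pose Sm := GRing.isLinear.Build R U U *:%R S (adjoint_linear _ sS).
pose Sl : {linear U -> U} := HB.pack S Sm.
exists Sl; split => //.
apply: bounded_linear_continuous; apply/linear_boundedP.
exists k; split; first exact: num_real.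
by move=> x /ltW kx u; rewrite (le_trans (bS u))// ler_wpM2r.
Qed.

(** The spectrum of a nonnegative operator is nonnegative, because
    [A - l] is coercive for [l < 0]. *)
Lemma spectrum_ge0 A t : selfadjoint A -> (forall u, 0 <= hdot (A u) u) ->
  spectrum A t -> 0 <= t.
Proof.
move=> aA A0; apply: contraPT; rewrite -ltNge => t0.
apply: invertible_notin_spectrum => //.
apply: (@coercive_invertible _ _ _ (- t)); first by rewrite oppr_gt0.
  exact: selfadjoint_shift.
by move=> u; rewrite hdotBl hdotZl hdot_norm mulNr lerDr.
Qed.

(** One half of the spectral mapping theorem.  Over the reals, a polynomial is
    a product of linear factors, whose values at [A] are invertible when the
    root lies outside the spectrum, and of quadratic factors
    [(X - a)^2 + b^2], whose values at [A] are coercive. *)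
Lemma poly_op_invertible q A : selfadjoint A -> q != 0 ->
  (forall t, spectrum A t -> q.[t] != 0) -> invertible (poly_op q A).
Proof.
move=> aA; have [sA bA] := aA; have lA := adjoint_linear _ sA.
have [n] := ubnP (size q); elim: n q => // n IH q; rewrite ltnS => sq q0 qs.
have step (f : {poly R}) : (1 < size f)%N -> f %| q -> invertible (poly_op f A) ->
    invertible (poly_op q A).
  move=> sf /dvdpP[g qE] If.
  have g0 : g != 0 by apply: contra_neq q0 => g0; rewrite qE g0 mul0r.
  have f0 : f != 0 by rewrite -size_poly_gt0 (leq_trans _ sf).
  have Ig : invertible (poly_op g A).
    apply: IH => //.
      rewrite (leq_trans _ sq)// qE size_mul//.
      by case: (size f) sf => [|[|m]]// _; rewrite addnS /= addnS ltnS leq_addr.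
    by move=> t /qs; rewrite qE hornerM mulf_eq0 negb_or => /andP[].
  have := invertible_comp _ _ Ig If; congr invertible; apply/funext => u /=.
  by rewrite qE poly_opM.
have [s1|s1] := leqP (size q) 1.
  have [c qE] : exists c, q = c%:P by exists q`_0; exact: size1_polyC.
  have c0 : c != 0 by rewrite -polyC_eq0 -qE.
  exists (fun u => c^-1 *: u); split.
  - have := bounded_lin _ _ c^-1 bounded_id (@bounded0 _ U); congr bounded_op.
    by apply/funext => u; rewrite addr0.
  - by move=> u; rewrite qE poly_opC scalerA mulVf ?scale1r.
  - by move=> u; rewrite qE poly_opC scalerA mulfV ?scale1r.
have [[a ra]|[a [b [b0 dq]]]] := real_root_or_quadratic_factor q s1.
  apply: (step ('X - a%:P)); rewrite ?size_XsubC ?dvdp_XsubCl//.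
  have /notin_spectrum_invertible : ~ spectrum A a.
    by move=> /qs; rewrite (eqP ra) eqxx.
  by congr invertible; apply/funext => u; rewrite poly_opB poly_opX poly_opC.
apply: (step _ _ dq).
  by rewrite size_polyDl size_exp_XsubC// (leq_ltn_trans (size_polyC_leq1 _)).
apply: (@coercive_invertible _ _ _ (b ^+ 2)); first by rewrite exprn_even_gt0.
  exact: selfadjoint_poly_op.
move=> u; rewrite poly_opD poly_opC hdotDl hdotZl hdot_norm lerDr.
have [sX _] := selfadjoint_poly_op ('X - a%:P) _ aA.
by rewrite expr2 poly_opM// sX hdot_norm sqr_ge0.
Qed.

(** If the infimum [m] of the numerical range of [q(A)] were less than [c],
    then [q - m] would have no root in the spectrum, and [q(A) - m] would be
    invertible. *)
Lemma poly_op_ge q A c : selfadjoint A ->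
  (forall t, spectrum A t -> c <= q.[t]) ->
  forall u, c * `|u| ^+ 2 <= hdot (poly_op q A u) u.
Proof.
move=> aA qc u; have [->|u0] := eqVneq u 0.
  by rewrite normr0 expr0n mulr0 hdotC hdot0l.
have [m mq mI] := numerical_range_bottom _ _ u0 (selfadjoint_poly_op q _ aA).
apply: le_trans (mq u); rewrite ler_wpM2r ?sqr_ge0// leNgt; apply/negP => mc.
(* A point of the spectrum is needed to see that [q - m] is not 0. *)
have [l _ lI] := numerical_range_bottom _ _ u0 aA.
have {lI} sl : spectrum A l.
  by apply: contrapT => /notin_spectrum_invertible.
apply: mI; have : invertible (poly_op (q - m%:P) A).
  have mt t : spectrum A t -> (q - m%:P).[t] != 0.
    by move=> /qc h; rewrite !hornerE subr_eq0 gt_eqF// (lt_le_trans mc).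
  apply: poly_op_invertible => //.
  by apply: contra_neq (mt _ sl) => ->; rewrite horner0.
by congr invertible; apply/funext => w; rewrite poly_opB poly_opC.
Qed.

End Spectrum.

(** * The interpolation inequality for fractional powers *)

Section FractionalPowers.
Context {R : realType}.
Implicit Types (x s t a e lam nu p : R).

(** For [t <= lam] the left-hand side is at most its value at [lam], and for
    [t >= lam] it is at most [t / lam] times that value, as [2 * nu <= 1]. *)
Lemma powR_sqr_le_linear t lam nu : 0 <= t -> 0 < lam -> 0 <= nu ->
  nu <= 2^-1 -> (t `^ nu) ^+ 2 <= (lam `^ nu) ^+ 2 * (1 + t / lam).
Proof.
move=> t0 lam0 nu0 nu1.
have [x tE] : exists x, t = lam * x by exists (t / lam); rewrite mulrC divfK ?gt_eqF.
have x0 : 0 <= x by move: t0; rewrite tE pmulr_rge0.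
rewrite tE powRM ?(ltW lam0)// exprMn [lam * x / lam]mulrAC divff ?gt_eqF// mul1r.
rewrite ler_wpM2l ?sqr_ge0//.
have [x1|x1] := lerP x 1.
  apply: (@le_trans _ _ 1); last by rewrite lerDl.
  rewrite expr_le1 ?powR_ge0//; have : 1 `^ nu = 1 :> R by rewrite powR1.
  by move=> <-; rewrite ge0_ler_powR// nnegrE.
apply: (@le_trans _ _ x); last by rewrite lerDr.
rewrite -[leRHS]sqr_sqrtr// -powR12_sqrt// lerXn2r ?nnegrE ?powR_ge0//.
by rewrite ler_powR// ltW.
Qed.

(** A substitute for the subadditivity of a power with exponent at most 1. *)
Lemma powRD_le p s t : 0 <= p -> p <= 1 -> 0 <= s -> 0 <= t ->
  (s + t) `^ p <= 2 * (s `^ p + t `^ p).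
Proof.
move=> p0 p1; wlog st : s t / s <= t => [H|] s0 t0.
  have [/H|/ltW/H] := leP s t; first exact.
  by rewrite addrC [s `^ p + _]addrC; exact.
have h : (s + t) `^ p <= (2 * t) `^ p.
  by rewrite ge0_ler_powR ?nnegrE ?addr_ge0 ?mulr_ge0//; lra.
rewrite (le_trans h)// powRM// (@le_trans _ _ (2 * t `^ p))//.
  by rewrite ler_wpM2r ?powR_ge0// ler1_powR// ler1n.
by rewrite ler_wpM2l// lerDr powR_ge0.
Qed.

(** Young's inequality with exponents [1 / nu] and [1 / (1 - nu)], up to the
    constant.  If the left-hand side is positive, then [s `^ (2 - 2 * nu)] is
    less than [2 * e * a], and [s `^ (2 * nu)] is a power of it. *)
Lemma powR_absorb e a nu s : 0 < e -> 0 < a -> 0 < nu -> nu < 1 -> 0 <= s ->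
  e * s `^ (2 * nu) - s ^+ 2 / (2 * a) <= e * (2 * e * a) `^ (nu / (1 - nu)).
Proof.
move=> e0 a0 nu0 nu1; rewrite le0r => /predU1P[->|s0].
  rewrite powR0 ?mulf_neq0 ?gt_eqF// mulr0 expr0n mul0r subr0.
  by rewrite mulr_ge0 ?powR_ge0 ?ltW.
have a20 : 0 < 2 * a by rewrite mulr_gt0.
have [h|h] := leP (e * s `^ (2 * nu)) (s ^+ 2 / (2 * a)).
  by rewrite (@le_trans _ _ 0) ?subr_le0 ?mulr_ge0 ?powR_ge0 ?(ltW e0).
apply: (@le_trans _ _ (e * s `^ (2 * nu))).
  by rewrite gerBl divr_ge0 ?sqr_ge0 ?ltW.
rewrite ler_pM2l//.
have sE : s ^+ 2 = s `^ (2 * nu) * s `^ (2 - 2 * nu).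
  rewrite -powRD; last by rewrite (gt_eqF s0) implybT.
  by rewrite addrC subrK powR_mulrn// ltW.
have sp : 0 < s `^ (2 * nu) by rewrite powR_gt0.
have hs : s `^ (2 - 2 * nu) <= 2 * e * a.
  move: h; rewrite ltr_pdivrMr// sE => /ltW.
  have -> : e * s `^ (2 * nu) * (2 * a) = s `^ (2 * nu) * (2 * e * a) by ring.
  by rewrite ler_pM2l.
have -> : 2 * nu = (2 - 2 * nu) * (nu / (1 - nu)).
  by field; rewrite subr_eq0 gt_eqF.
rewrite (powRrM s) ge0_ler_powR ?nnegrE ?powR_ge0 ?mulr_ge0 ?(ltW e0) ?(ltW a0)//.
  exact: ltW.
by rewrite invr_ge0 subr_ge0 ltW.
Qed.

Section Hilbert.
Context {U : hilbertType R}.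
Implicit Types (A B : U -> U) (f : R -> R) (u w : U).

(** Symmetry passes from the polynomials in [A] to their limit. *)
Lemma spectral_calculus_adjoint A f B : selfadjoint A ->
  is_spectral_calculus A f B -> is_adjoint B B.
Proof.
move=> aA [p [_ cB]] u w.
apply/eqP; rewrite -subr_eq0 -normr_le0; apply/ler_addgt0Pl => e e0; rewrite addr0.
pose k := 2 * `|u| * `|w| + 1.
have k0 : 0 < k by rewrite ltr_wpDl ?mulr_ge0.
have [n _ /(_ n (leqnn n)) Pn] := cB (e / k) (divr_gt0 e0 k0).
have [sP _] := selfadjoint_poly_op (p n) _ aA.
have -> : hdot (B u) w - hdot u (B w) =
    hdot u (poly_op (p n) A w - B w) - hdot (poly_op (p n) A u - B u) w.
  by rewrite hdotBl hdotBr sP; ring.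
rewrite (le_trans (ler_normB _ _))//.
have h1 := le_trans (hdot_norm_le _ _) (ler_wpM2l (normr_ge0 u) (Pn w)).
have h2 := le_trans (hdot_norm_le _ _) (ler_wpM2r (normr_ge0 w) (Pn u)).
rewrite (le_trans (lerD h1 h2))//.
rewrite [leLHS](_ : _ = e / k * (2 * `|u| * `|w|)); last by ring.
by rewrite mulrAC ler_pdivrMr// ler_pM2l// lerDl.
Qed.

(** The approximation error is chosen of the size [lam `^ nu], which the
    right-hand side absorbs, so that no limit has to be taken.
    On the spectrum a polynomial [p] within [lam `^ nu] of [t `^ nu] satisfies
    [p(t)^2 <= (lam `^ nu)^2 * (4 + 2 * t / lam)] by [powR_sqr_le_linear]; this
    comparison of polynomials carries over to operators by [poly_op_ge].  An
    optimal [lam] turns the bound into the usual interpolation inequality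
    [|A^nu u| <= const * <A u, u>^nu * |u|^(1 - 2 nu)]. *)
Lemma fractional_power_interpolation A nu B lam u :
  selfadjoint A -> (forall w, 0 <= hdot (A w) w) -> 0 <= nu -> nu <= 2^-1 ->
  is_fractional_power A nu B -> 0 < lam ->
  `|B u| ^+ 2 <= 10 * (lam `^ nu) ^+ 2 * (`|u| ^+ 2 + hdot (A u) u / lam).
Proof.
move=> aA A0 nu0 nu1 [p [cp cB]] lam0.
set e := lam `^ nu; have e0 : 0 < e by exact: powR_gt0.
have [n [pn Bn]] : exists n,
    (forall t, spectrum A t -> `|t `^ nu - (p n).[t]| < e) /\
    (forall w, `|poly_op (p n) A w - B w| <= e * `|w|).
  pose E := [set xy : R * R | ball xy.1 e xy.2].
  have /cp[n1 _ H1] : nbhs ((fun t => t `^ nu) : {uniform` spectrum A -> R})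
      [set h | forall t, spectrum A t -> E (t `^ nu, h t)].
    by apply/uniform_nbhs; exists E; split => //; exact: entourage_ball (PosNum e0).
  have [n2 _ H2] := cB e e0.
  exists (maxn n1 n2); split; last exact: H2 (leq_maxr _ _).
  exact: H1 (leq_maxl _ _).
pose q := (4 * e ^+ 2)%:P + (2 * e ^+ 2 / lam) *: 'X - p n * p n.
have q0 t : spectrum A t -> 0 <= q.[t].
  move=> st; have t0 := spectrum_ge0 _ _ aA A0 st.
  have := powR_sqr_le_linear _ _ _ t0 lam0 nu0 nu1; rewrite -/e => h.
  have hn := pn _ st.
  have -> : q.[t] = 4 * e ^+ 2 + 2 * (e ^+ 2 * (t / lam)) - (p n).[t] ^+ 2.
    rewrite /q hornerD hornerN hornerM hornerD hornerC hornerZ hornerX; ring.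
  rewrite mulrDr mulr1 in h.
  have hd : (t `^ nu - (p n).[t]) ^+ 2 <= e ^+ 2.
    by rewrite -real_normK ?num_real// lerXn2r ?nnegrE ?(ltW e0)// ltW.
  (* The parallelogram inequality [p^2 <= 2 (t^nu)^2 + 2 (t^nu - p)^2]. *)
  have := sqr_ge0 (2 * t `^ nu - (p n).[t]).
  nra.
have := poly_op_ge _ _ _ aA q0 u; rewrite mul0r.
have [sP _] := selfadjoint_poly_op (p n) _ aA.
rewrite poly_opB poly_opD poly_opC poly_opZ poly_opX.
rewrite (poly_opM _ _ _ _ (adjoint_linear _ aA.1)) hdotBl hdotDl !hdotZl sP !hdot_norm.
move=> h; have := Bn u; set P := poly_op (p n) A u in h *.
move=> hB.
have hB2 : `|P - B u| ^+ 2 <= e ^+ 2 * `|u| ^+ 2.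
  by rewrite -exprMn lerXn2r ?nnegrE ?mulr_ge0 ?(ltW e0).
have hpar : `|B u| ^+ 2 <= 2 * `|P| ^+ 2 + 2 * `|P - B u| ^+ 2.
  have := sqr_ge0 `|2 *: P - B u|; rewrite !hdot_normB hdotZl normrZ exprMn.
  by rewrite ger0_norm//; nra.
have Aq : 0 <= e ^+ 2 * (hdot (A u) u / lam).
  by rewrite mulr_ge0 ?sqr_ge0// divr_ge0// ltW.
have -> : 10 * e ^+ 2 * (`|u| ^+ 2 + hdot (A u) u / lam) =
  10 * (e ^+ 2 * `|u| ^+ 2) + 10 * (e ^+ 2 * (hdot (A u) u / lam)) by ring.
have hE : 2 * e ^+ 2 / lam * hdot (A u) u = 2 * (e ^+ 2 * (hdot (A u) u / lam)).
  by ring.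
rewrite hE in h; lra.
Qed.

End Hilbert.
End FractionalPowers.

(** * Tikhonov regularisation under a fractional source condition *)

Section Regularisation.
Context {R : realType} {U V : hilbertType R}.
Variables (F : {linear U -> V}) (Fs : V -> U).
Hypotheses (F_bounded : bounded_near F (nbhs (0 : U)))
  (Fs_adjoint : is_adjoint F Fs).

Lemma hdot_normal_op u w : hdot ((Fs \o F) u) w = hdot (F u) (F w).
Proof. by rewrite hdotC /= -Fs_adjoint hdotC. Qed.

Lemma normal_op_selfadjoint : selfadjoint (Fs \o F).
Proof.
split; first by move=> u w; rewrite hdot_normal_op Fs_adjoint.
have /linear_boundedP/pinfty_ex_gt0[k k0 bF] := F_bounded.
exists (k * k) => [|u /=]; first exact: mulr_gt0.
have bFs v : `|Fs v| <= k * `|v|.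
  have [->|v0] := eqVneq (Fs v) 0; first by rewrite normr0 mulr_ge0// ltW.
  have n0 : 0 < `|Fs v| by rewrite normr_gt0.
  rewrite -(ler_pM2l n0) -expr2 -hdot_norm -Fs_adjoint.
  rewrite (le_trans (hdot_le _ _))// mulrA (mulrC _ k).
  by rewrite ler_wpM2r// bF.
by rewrite (le_trans (bFs _))// -mulrA ler_pM2l// bF.
Qed.

(** [fractional_power_interpolation] at [lam = s^2], where [<A w, w> / lam] is
    at most 1 because [<A w, w> = |F w|^2]. *)
Lemma source_element_le nu B omega w s : 0 <= nu -> nu <= 2^-1 ->
  is_fractional_power (Fs \o F) nu B -> 0 < s -> `|F w| <= s ->
  `|hdot (B omega) w| <= 4 * `|omega| * (`|w| + 1) * s `^ (2 * nu).
Proof.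
move=> nu0 nu1 hB s0 Fw.
have aA := normal_op_selfadjoint.
have A0 u : 0 <= hdot ((Fs \o F) u) u.
  by rewrite hdot_normal_op hdot_norm sqr_ge0.
have s20 : 0 < s ^+ 2 by rewrite exprn_gt0.
have := fractional_power_interpolation _ _ _ _ w aA A0 nu0 nu1 hB s20.
rewrite hdot_normal_op hdot_norm.
have -> : (s ^+ 2) `^ nu = s `^ (2 * nu) by rewrite powRrM powR_mulrn// ltW.
set e := s `^ (2 * nu) => h; have e0 : 0 <= e by exact: powR_ge0.
have q1 : `|F w| ^+ 2 / s ^+ 2 <= 1.
  by rewrite ler_pdivrMr// mul1r lerXn2r ?nnegrE// ltW.
have Bw : `|B w| <= 4 * (`|w| + 1) * e.
  rewrite -(@ler_pXn2r _ 2) ?nnegrE ?mulr_ge0 ?addr_ge0//.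
  apply: (le_trans h); rewrite [leLHS]mulrAC !exprMn ler_wpM2r ?sqr_ge0//.
  have := normr_ge0 w; nra.
rewrite (spectral_calculus_adjoint _ _ _ aA hB).
rewrite (le_trans (hdot_norm_le _ _))// (le_trans (ler_wpM2l _ Bw))//.
by rewrite le_eqVlt; apply/orP; left; apply/eqP; ring.
Qed.

(** The value of the functional at [ua] is at most its value at [ud], where
    the residual is at most [delta]; divide by [alpha]. *)
Lemma tikhonov_minimiser_le (J : U -> \bar R) ud alpha delta v ua :
  (forall u, (0 <= J u)%E) -> (J ud < +oo)%E -> 0 < alpha ->
  `|v - F ud| <= delta -> is_argmin (tikhonov F J alpha v) setT ua ->
  exists ja jd : R, [/\ J ua = ja%:E, J ud = jd%:E &
    ja + `|F ua - v| ^+ 2 / (2 * alpha) <= jd + 2^-1 * (delta ^+ 2 / alpha)].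
Proof.
move=> J0 Jud a0 hv [_ /(_ ud I)]; rewrite /tikhonov.
have : (J ud \is a fin_num)%E by rewrite ge0_fin_numE.
move=> /fineK <-; set jd := fine _.
have := J0 ua; case: (J ua) => [ja _|_|//]; last first.
  by rewrite gt0_muley ?lte_fin// addey// -EFinM -EFinD leye_eq.
rewrite -!EFinM -!EFinD lee_fin => h; exists ja, jd; split => //.
have h2 : `|F ud - v| ^+ 2 <= delta ^+ 2.
  by rewrite distrC lerXn2r ?nnegrE// (le_trans _ hv).
rewrite -(ler_pM2l a0).
have -> : alpha * (ja + `|F ua - v| ^+ 2 / (2 * alpha)) =
    2^-1 * `|F ua - v| ^+ 2 + alpha * ja by field; rewrite gt_eqF.
have -> : alpha * (jd + 2^-1 * (delta ^+ 2 / alpha)) =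
    2^-1 * delta ^+ 2 + alpha * jd by field; rewrite gt_eqF.
by rewrite (le_trans h)// lerD2r ler_wpM2l// invr_ge0.
Qed.

(** As [J ua <= J ud + M / 2], coercivity bounds [ua - ud], so that the linear
    term of the Bregman distance is at most a multiple of
    [(n + delta)^(2 nu)], where [n] is the residual norm [|F ua - v|].  The
    minimality of [ua] leaves a term [- n^2 / (2 alpha)], which absorbs the
    power of [n] by [powR_absorb]. *)
Lemma tikhonov_bregman_le (J : U -> \bar R) ud nu B omega M :
  (forall u, (0 <= J u)%E) -> coercive J -> (J ud < +oo)%E ->
  0 < nu -> nu <= 2^-1 -> is_fractional_power (Fs \o F) nu B ->
  exists C1 C2 C3 : R, [/\ 0 < C1, 0 < C2, 0 < C3 &
    forall (delta alpha : R) (v : V) (ua : U),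
      0 < delta -> 0 < alpha -> delta ^+ 2 / alpha <= M ->
      `|v - F ud| <= delta -> is_argmin (tikhonov F J alpha v) setT ua ->
      (bregman J (B omega) ua ud <=
         (C1 * (delta ^+ 2 / alpha) + C2 * delta `^ (2 * nu)
          + C3 * alpha `^ (nu / (1 - nu)))%:E)%E].
Proof.
move=> J0 Jc Jud nu0 nu1 hB.
have nu_lt1 : nu < 1 by lra.
have [r hr] := Jc (fine (J ud) + 2^-1 * M + 1).
pose k := `|r| + `|ud|.
have k0 : 0 <= k by rewrite addr_ge0.
(* The summand 1 keeps the constants positive when omega is 0. *)
pose e := 4 * `|omega| * (k + 1) + 1.
have e0 : 0 < e by rewrite ltr_wpDl// !mulr_ge0// addr_ge0.
have e20 : 0 < 2 * e by rewrite mulr_gt0.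
exists 2^-1, (2 * e), (2 * e * (2 * (2 * e)) `^ (nu / (1 - nu))).
split => //; first by rewrite !mulr_gt0 ?powR_gt0 ?mulr_gt0.
move=> delta alpha v ua d0 a0 dM hv hmin.
have [ja [jd [ea ed hj]]] :=
  tikhonov_minimiser_le _ _ _ _ _ _ J0 Jud a0 hv hmin.
rewrite /bregman ea ed -!EFinB lee_fin.
set n := `|F ua - v| in hj *.
have n0 : 0 <= n by exact: normr_ge0.
have nn : 0 <= n ^+ 2 / (2 * alpha) by rewrite divr_ge0 ?sqr_ge0// mulr_ge0// ltW.
have hua : `|ua - ud| <= k.
  rewrite (le_trans (ler_normB _ _))// lerD2r (le_trans _ (ler_norm r))//.
  rewrite leNgt; apply/negP => /ltW /hr; rewrite ea ed lee_fin /=; lra.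
have Fu : `|F (ua - ud)| <= n + delta.
  rewrite linearB -(subrKA v (F ua)) (le_trans (ler_normD _ _))// lerD//.
have hxi : `|hdot (B omega) (ua - ud)| <= e * (n + delta) `^ (2 * nu).
  have nd : 0 < n + delta by rewrite ltr_wpDl.
  apply: (le_trans (source_element_le _ _ omega _ _ (ltW nu0) nu1 hB nd Fu)).
  rewrite ler_wpM2r ?powR_ge0// (@le_trans _ _ (4 * `|omega| * (k + 1)))//.
    by rewrite ler_wpM2l ?mulr_ge0// lerD2r.
  by rewrite lerDl.
have hsum : e * (n + delta) `^ (2 * nu) <=
    2 * e * n `^ (2 * nu) + 2 * e * delta `^ (2 * nu).
  rewrite -mulrDr [2 * e]mulrC -[leRHS]mulrA ler_pM2l// powRD_le ?(ltW d0)//; lra.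
have hyoung := powR_absorb _ _ _ _ e20 a0 nu0 nu_lt1 n0.
rewrite powRM ?(ltW a0) ?mulr_ge0 ?(ltW e0)// mulrA in hyoung.
have := ler_norm (- hdot (B omega) (ua - ud)); rewrite normrN => hneg.
lra.
Qed.

End Regularisation.

(** * A priori choice of the parameter *)

Section ParameterChoice.
Context {R : realType}.
Implicit Types c nu delta alpha : R.

Lemma sqr_div_le_powR c nu delta alpha : 0 < c -> 0 < delta ->
  c * delta `^ (2 - 2 * nu) <= alpha ->
  delta ^+ 2 / alpha <= c^-1 * delta `^ (2 * nu).
Proof.
move=> c0 d0 ha; have p0 : 0 < delta `^ (2 - 2 * nu) by rewrite powR_gt0.
have a0 : 0 < alpha by rewrite (lt_le_trans _ ha)// mulr_gt0.
have dE : delta ^+ 2 = delta `^ (2 * nu) * delta `^ (2 - 2 * nu).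
  rewrite -powRD; last by rewrite (gt_eqF d0) implybT.
  by rewrite addrC subrK powR_mulrn// ltW.
by rewrite ler_pdivrMr// -mulrA ler_pdivlMl// dE mulrCA ler_pM2l ?powR_gt0.
Qed.

Lemma powR_le_powR c nu delta alpha : 0 <= c -> 0 <= nu -> nu < 1 ->
  0 <= alpha -> alpha <= c * delta `^ (2 - 2 * nu) ->
  alpha `^ (nu / (1 - nu)) <= c `^ (nu / (1 - nu)) * delta `^ (2 * nu).
Proof.
move=> c0 nu0 nu1 a0 ha.
have -> : 2 * nu = (2 - 2 * nu) * (nu / (1 - nu)).
  by field; rewrite subr_eq0 gt_eqF.
rewrite (powRrM delta) -powRM ?powR_ge0// ge0_ler_powR ?nnegrE ?mulr_ge0 ?powR_ge0//.
by rewrite invr_ge0 subr_ge0 ltW.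
Qed.

End ParameterChoice.

Theorem theorem7 (R : realType) (U V : hilbertType R)
  (F : {linear U -> V}) (F_bounded : bounded_near F (nbhs (0 : U)))
  (J : U -> \bar R)
  (J_ge0 : forall u, (0 <= J u)%E)
  (J_convex : convex_functional J)
  (J_lsc : lower_semicontinuous J)
  (J_coercive : coercive J)
  (vd : V) (ud : U)
  (ud_argmin : is_argmin J [set u | F u = vd] ud)
  (nu : R) (nu_gt0 : 0 < nu) (nu_le : nu <= 2^-1)
  (Fs : V -> U) (Fs_adjoint : is_adjoint F Fs)
  (FsF_nu : U -> U) (FsF_nuP : is_fractional_power (Fs \o F) nu FsF_nu)
  (omega xi : U) (xi_source : xi = FsF_nu omega)
  (xi_subdiff : subdifferential J ud xi) :
  (forall M : R, 0 < M ->
     exists C1 C2 C3 : R, [/\ 0 < C1, 0 < C2, 0 < C3 &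
       forall (delta alpha : R) (v : V) (ua : U),
         0 < delta -> 0 < alpha -> delta ^+ 2 / alpha <= M ->
         `|v - vd| <= delta ->
         is_argmin (tikhonov F J alpha v) setT ua ->
         (bregman J xi ua ud <=
            (C1 * (delta ^+ 2 / alpha) + C2 * delta `^ (2 * nu)
             + C3 * alpha `^ (nu / (1 - nu)))%:E)%E])
  /\
  (forall c c' : R, 0 < c -> c <= c' ->
     exists delta0 C : R, [/\ 0 < delta0, 0 < C &
       forall (delta alpha : R) (v : V) (ua : U),
         0 < delta -> delta <= delta0 ->
         c * delta `^ (2 - 2 * nu) <= alpha ->
         alpha <= c' * delta `^ (2 - 2 * nu) ->
         `|v - vd| <= delta ->
         is_argmin (tikhonov F J alpha v) setT ua ->
         (bregman J xi ua ud <= (C * delta `^ (2 * nu))%:E)%E]).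
Proof.
have [Fud _] := ud_argmin.
have [Jud _] := xi_subdiff.
have rate M := tikhonov_bregman_le F Fs F_bounded Fs_adjoint J ud nu FsF_nu
  omega M J_ge0 J_coercive Jud nu_gt0 nu_le FsF_nuP.
rewrite -Fud xi_source; split; first by move=> M _; exact: rate.
move=> c c' c0 cc'.
have c'0 : 0 < c' by exact: lt_le_trans cc'.
have [C1 [C2 [C3 [C10 C20 C30 H]]]] := rate c^-1.
exists 1, (C1 / c + C2 + C3 * c' `^ (nu / (1 - nu))); split => //.
  by rewrite !addr_gt0 ?divr_gt0 ?mulr_gt0 ?powR_gt0.
move=> delta alpha v ua d0 d1 ha ha' hv hmin.
have a0 : 0 < alpha by rewrite (lt_le_trans _ ha)// mulr_gt0 ?powR_gt0.
have h1 := sqr_div_le_powR _ _ _ _ c0 d0 ha.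
have h2 : alpha `^ (nu / (1 - nu)) <=
    c' `^ (nu / (1 - nu)) * delta `^ (2 * nu).
  by apply: powR_le_powR ha'; rewrite ?ltW//; lra.
have h3 : delta `^ (2 * nu) <= 1.
  have e1 : 1 `^ (2 * nu) = 1 :> R by rewrite powR1.
  by rewrite -[leRHS]e1 ge0_ler_powR ?nnegrE ?mulr_ge0 ?(ltW nu_gt0) ?(ltW d0).
have hM : delta ^+ 2 / alpha <= c^-1.
  by rewrite (le_trans h1)// ler_piMr// invr_ge0 ltW.
apply: le_trans (H _ _ _ _ d0 a0 hM hv hmin) _; rewrite lee_fin.
set d := delta `^ (2 * nu) in h1 h2 *; set q := c' `^ _ in h2 *.
have -> : (C1 / c + C2 + C3 * q) * d =
    C1 * (c^-1 * d) + C2 * d + C3 * (q * d) by ring.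
by rewrite !lerD// ler_pM2l.
Qed.
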